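(* Let $G=(V,E)$ be a graph on $n$ vertices, let $\mathcal{C}$ be the family of non-empty cliques of $G$ and let $\mathcal{S}$ be the family of non-empty stable sets of $G$. Then $$|\mathcal{C}|\,|\mathcal{S}|\leq n(2^n-1).$$ Moreover, equality holds if and only if $G$ or its complement is a clique.
   Context: Graphs are finite, simple and undirected. A clique of $G$ is a set of pairwise adjacent vertices and a stable set is a set of pairwise non-adjacent vertices (singletons are both cliques and stable sets). ''$G$ is a clique'' means that $G$ is the complete graph $K_n$. *)

(* Defs.v *)
From mathcomp Require Import all_boot.

Set Implicit Arguments.
Unset Strict Implicit.
Unset Printing Implicit Defensive.

Record sgraph (V : finType) := SGraph {
  adj :> rel V;
  adj_sym : symmetric adj;
  adj_irrefl : irreflexive adj
}.

Section Graphs.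
Variables (V : finType) (G : sgraph V).

Definition clique (A : {set V}) : bool :=
  [forall x in A, forall y in A, (x != y) ==> G x y].

Definition stable (A : {set V}) : bool :=
  [forall x in A, forall y in A, (x != y) ==> ~~ G x y].

Definition cliques : {set {set V}} := [set A | (A != set0) && clique A].

Definition stables : {set {set V}} := [set A | (A != set0) && stable A].

Definition complete : Prop := forall x y : V, x != y -> G x y.

Definition compl_adj : rel V := fun x y => (x != y) && ~~ G x y.

Fact compl_adj_sym : symmetric compl_adj.
Proof. by move=> x y; rewrite /compl_adj eq_sym adj_sym. Qed.

Fact compl_adj_irrefl : irreflexive compl_adj.
Proof. by move=> x; rewrite /compl_adj eqxx. Qed.

Definition compl_graph : sgraph V := SGraph compl_adj_sym compl_adj_irrefl.

End Graphs.

(* Main.v *)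
Require Import Defs.
From mathcomp Require Import all_boot zify.

(** Sort the pairs (K, S) of a non-empty clique and a non-empty stable set by
    their union W = K :|: S.  Since the sum of 2 * #|W| over all W is n * 2 ^ n
    and there are n singletons, the bound n * (2 ^ n - 1) follows once each W
    is the union of at most 2 * #|W| pairs, and of at most one if #|W| = 1.

    A clique meets a stable set in at most one vertex, so the pairs with union
    W are of two kinds.
    - If K and S meet in v, then v determines both: K is the closed
      neighbourhood of v in W and S is the rest of W together with v.  The
      vertices that arise are the swing vertices of W, so there are at most
      #|W| such pairs.
    - If K and S are disjoint, they form a split partition of W.  Deleting a
      vertex v maps the split partitions of W to those of W :\ v, and it
      identifies two of them only if v can be moved from one side to the other,
      that is, if v is a swing vertex; moreover this happens for at most one
      pair of partitions ([split_parts_del]).  Induction bounds their number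
      by #|W|.+1.  If W is a clique or a stable set, one of these partitions
      has an empty side and is not counted, which leaves at most #|W|.

    For the case of equality the key is [swing_full]: if every vertex of W is a
    swing vertex, W is a clique or a stable set.  Otherwise both counts lose
    one: some vertex is not swing, and deleting that vertex first in the
    induction gives at most #|W| split partitions.  So W has fewer than
    2 * #|W| pairs ([card_fiber_lt]), and taking W to be the whole vertex set
    shows that equality forces the graph or its complement to be complete. *)

Set Implicit Arguments.
Unset Strict Implicit.
Unset Printing Implicit Defensive.

Section Fibers.
Variables (V : finType) (G : sgraph V).
Implicit Types (A B K S W : {set V}) (u v x y : V).

(** * Cliques and stable sets *)

Lemma cliqueP A :
  reflect {in A &, forall x y, x != y -> G x y} (clique G A).
Proof.
apply: (iffP forall_inP) => [h x y xA yA|h x xA].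
  by move/forall_inP: (h x xA) => /(_ y yA)/implyP.
by apply/forall_inP => y yA; apply/implyP; apply: h.
Qed.

Lemma stableP A :
  reflect {in A &, forall x y, x != y -> ~~ G x y} (stable G A).
Proof.
apply: (iffP forall_inP) => [h x y xA yA|h x xA].
  by move/forall_inP: (h x xA) => /(_ y yA)/implyP.
by apply/forall_inP => y yA; apply/implyP; apply: h.
Qed.

Lemma cliqueS A B : A \subset B -> clique G B -> clique G A.
Proof.
by move=> /subsetP sAB /cliqueP h; apply/cliqueP => x y /sAB xB /sAB; apply: h.
Qed.

Lemma stableS A B : A \subset B -> stable G B -> stable G A.
Proof.
by move=> /subsetP sAB /stableP h; apply/stableP => x y /sAB xB /sAB; apply: h.
Qed.

Lemma stable0 : stable G set0.
Proof. by apply/stableP => x y; rewrite inE. Qed.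

Lemma clique0 : clique G set0.
Proof. by apply/cliqueP => x y; rewrite inE. Qed.

Lemma clique1 x : clique G [set x].
Proof. by apply/cliqueP => y z; rewrite !inE => /eqP-> /eqP->; rewrite eqxx. Qed.

Lemma stable1 x : stable G [set x].
Proof. by apply/stableP => y z; rewrite !inE => /eqP-> /eqP->; rewrite eqxx. Qed.

(** * Swing vertices and split partitions *)

Definition nbhd v := [set x | G v x].

(** A swing vertex of W may be put on either side of some split
    partition of W. *)
Definition swing W :=
  [set v in W | clique G (v |: (W :&: nbhd v)) && stable G (W :\: nbhd v)].

(** The partition into K and W :\: K is recorded by its clique K alone. *)
Definition split_parts W :=
  [set K : {set V} | [&& K \subset W, clique G K & stable G (W :\: K)]].

(** Inside K :|: S, every vertex of K other than v is adjacent to v and no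
    vertex of S is. *)
Lemma clique_stable_meet K S v : clique G K -> stable G S ->
  v \in K -> v \in S -> K = v |: ((K :|: S) :&: nbhd v)
    /\ S = (K :|: S) :\: nbhd v.
Proof.
move=> /cliqueP hK /stableP hS vK vS; split; apply/setP => x; rewrite !inE.
  have [->|xv] := eqVneq x v; first by rewrite vK.
  case xK: (x \in K) => /=; first by rewrite hK // eq_sym.
  by case xS: (x \in S) => //=; apply/esym/negbTE; rewrite hS // eq_sym.
have [->|xv] := eqVneq x v; first by rewrite vK vS adj_irrefl.
case xS: (x \in S); first by rewrite orbT andbT; apply/esym; rewrite hS // eq_sym.
by case xK: (x \in K); rewrite ?andbF //= hK // eq_sym.
Qed.

Lemma swing_meet K S v : clique G K -> stable G S -> v \in K -> v \in S ->
  v \in swing (K :|: S).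
Proof.
move=> hK hS vK vS; have [eK eS] := clique_stable_meet hK hS vK vS.
by rewrite inE -eK -eS hK hS inE vK.
Qed.

(** The hypothesis says that being equal or adjacent, and likewise being equal
    or non-adjacent, is transitive on W.  If W has an edge u v, a vertex not
    adjacent to u is not adjacent to v either by the first property, and then
    the second one denies the edge; so u sees all of W, and W is a clique by
    the first property again. *)
Lemma swing_full W : swing W = W -> clique G W || stable G W.
Proof.
move=> full.
have adjT v x y : v \in W -> x \in W -> y \in W ->
    G v x -> G v y -> x != y -> G x y.
  rewrite -{1}full inE => /andP[_ /andP[/cliqueP h _]] xW yW vx vy.
  by apply: h; rewrite !inE ?xW ?yW ?vx ?vy orbT.
have nadjT v x y : v \in W -> x \in W -> y \in W ->
    ~~ G v x -> ~~ G v y -> x != y -> ~~ G x y.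
  rewrite -{1}full inE => /andP[_ /andP[_ /stableP h]] xW yW vx vy.
  by apply: h; rewrite !inE ?xW ?yW ?vx ?vy.
have [//|nst] := boolP (stable G W); first by rewrite orbT.
rewrite orbF.
have [u [v [uW vW uv]]] : exists u v, [/\ u \in W, v \in W & G u v].
  move: nst; rewrite negb_forall_in => /exists_inP[u uW].
  rewrite negb_forall_in => /exists_inP[v vW].
  by rewrite negb_imply negbK => /andP[_ uv]; exists u, v.
have nuv : u != v by apply: contraTneq uv => ->; rewrite adj_irrefl.
have dom z : z \in W -> z != u -> G u z.
  move=> zW zu; apply/negPn/negP => nuz.
  have [zv|nzv] := boolP (G v z).
    by move: nuz; rewrite (adjT v) // 1?adj_sym // eq_sym.
  move: (nadjT z u v zW uW vW).
  by rewrite uv ![G z _]adj_sym nuz nzv => /(_ isT isT nuv).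
apply/cliqueP => x y xW yW xy.
have [xu|xu] := eqVneq x u; first by rewrite xu dom // -xu eq_sym.
have [yu|yu] := eqVneq y u; first by rewrite yu adj_sym dom.
by apply: (adjT u); rewrite ?dom.
Qed.

(** Removing v sends a split partition of W to one of W :\ v.  A partition of
    W :\ v that extends with v on both sides has its clique K determined: then
    v |: K and W :\: K are a clique and a stable set meeting in v. *)
Lemma split_parts_del W v : v \in W ->
  #|split_parts W| <= #|split_parts (W :\ v)| + (v \in swing W).
Proof.
move=> vW.
pose P0 := [set K in split_parts W | v \notin K].
pose P1 := [set K in split_parts W | v \in K].
pose P1' := [set K :\ v | K in P1].
have cP1 : #|P1'| = #|P1|.
  rewrite card_in_imset // => K L; rewrite !inE => /andP[_ vK] /andP[_ vL] e.
  by rewrite -(setD1K vK) -(setD1K vL) e.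
have cP : #|split_parts W| = #|P0| + #|P1|.
  rewrite -(cardsID [set K : {set V} | v \in K] (split_parts W)) addnC.
  by congr (_ + _); apply: eq_card => K; rewrite !inE // andbC.
rewrite cP -cP1 -cardsUI leq_add //.
  apply/subset_leq_card/subsetP => K; rewrite inE => /orP[|/imsetP[L]].
    rewrite !inE => /andP[/and3P[KW hK hS] vK]; rewrite subsetD1 KW vK hK.
    by apply: stableS hS; apply/setSD/subsetDl.
  rewrite !inE => /andP[/and3P[LW hL hS] vL] ->.
  rewrite setSD // (cliqueS _ hL) ?subsetDl //=; apply: stableS hS.
  by apply/subsetP => x; rewrite !inE; case: (x == v).
have meet (K : {set V}) : K \in P0 :&: P1' -> v \in swing W /\ K = W :&: nbhd v.
  rewrite inE => /andP[K0 /imsetP[L]].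
  rewrite inE => /andP[L1 vL] eK; move: K0 L1.
  rewrite !inE => /andP[/and3P[KW hK hS] vK] /and3P[LW hL hT].
  have vS : v \in W :\: K by rewrite inE vK.
  have eL : L = v |: K by rewrite eK setD1K.
  have eW : L :|: (W :\: K) = W.
    rewrite eL -setUA setDE setUIr setUCr setIT (setUidPr KW).
    by apply/setUidPr; rewrite sub1set.
  split; first by have := swing_meet hL hS vL vS; rewrite eW inE.
  have [e _] := clique_stable_meet hL hS vL vS.
  rewrite eK e eW setU1K // !inE adj_irrefl andbF //.
have [sv|nsv] := boolP (v \in swing W).
  rewrite -[nat_of_bool true](cards1 (W :&: nbhd v)).
  apply/subset_leq_card/subsetP => K.
  by rewrite inE => /meet[_ ->].
rewrite leqn0 cards_eq0; apply/eqP/setP => K; rewrite [RHS]inE.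
by apply: contraNF nsv => /meet[].
Qed.

Lemma card_split_parts W : #|split_parts W| <= #|W|.+1.
Proof.
move cW: #|W| => m; elim: m W cW => [|m IH] W cW.
  rewrite -(cards1 (set0 : {set V})); apply/subset_leq_card/subsetP => K.
  move/eqP: cW; rewrite cards_eq0 => /eqP->.
  by rewrite !inE subset0 => /andP[].
have /card_gt0P[v vW] : 0 < #|W| by rewrite cW.
have cD : #|W :\ v| = m by move: (cardsD1 v W); rewrite vW cW => -[].
by have := split_parts_del vW; have := IH _ cD; lia.
Qed.

(** * Pairs with a given union *)

Definition fiber W :=
  [set p in setX (cliques G) (stables G) | p.1 :|: p.2 == W].

(** The first summand bounds the disjoint pairs, the second one the pairs that
    meet. *)
Lemma card_fiber_split W :
  #|fiber W| <= #|split_parts W :\ set0 :\ W| + #|swing W|.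
Proof.
pose part K := (K, W :\: K).
pose star v := (v |: (W :&: nbhd v), W :\: nbhd v).
apply: leq_trans (leq_add (leq_imset_card part _) (leq_imset_card star _)).
apply: leq_trans (leq_card_setU _ _).
apply/subset_leq_card/subsetP => -[K S]; rewrite !inE /=.
move=> /andP[/andP[/andP[K0 hK] /andP[S0 hS]] /eqP eW]; apply/orP.
have [dis|] := boolP (K :&: S == set0).
  have eS : S = W :\: K.
    rewrite -eW setDUl setDv set0U; apply/esym/setDidPl.
    by rewrite disjoint_sym -setI_eq0.
  left; apply/imsetP; exists K; last by rewrite /part -eS.
  rewrite !inE K0 hK -eS hS -{2}eW subsetUl !andbT /=.
  by apply: contraNneq S0 => eK; rewrite eS eK setDv.
case/set0Pn => v; rewrite inE => /andP[vK vS]; right.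
have [eK eS] := clique_stable_meet hK hS vK vS; apply/imsetP; exists v.
  by rewrite -eW swing_meet.
by rewrite /star -eW -eK -eS.
Qed.

Lemma card_swing W : #|swing W| <= #|W|.
Proof. by apply/subset_leq_card/subsetP => v; rewrite inE => /andP[]. Qed.

(** Some vertex v of W is not a swing vertex.  It is lost in the count of the
    meeting pairs, and deleting it identifies no two split partitions. *)
Lemma card_fiber_lt W : ~~ clique G W -> ~~ stable G W ->
  #|fiber W| + (#|W| == 1) < 2 * #|W|.
Proof.
move=> nK nS.
have W1 : #|W| != 1 by apply: contraNN nK => /cards1P[x ->]; apply: clique1.
have sW : swing W \subset W by apply/subsetP => v; rewrite inE => /andP[].
have : swing W \proper W.
  rewrite properEneq sW andbT; apply: contraNneq nK => /swing_full.
  by rewrite (negbTE nS) orbF.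
move=> /[dup] /proper_card lt_sw /properP[_ [v vW nsv]].
have := split_parts_del vW; rewrite (negbTE nsv).
have := card_split_parts (W :\ v); have := cardsD1 v W; rewrite vW.
have := subset_leq_card (subset_trans (subsetDl (split_parts W :\ set0) [set W])
                                       (subsetDl _ _)).
have := card_fiber_split W; lia.
Qed.

(** If W is a clique or a stable set, the split partition whose clique is W or
    set0 has an empty side, which compensates for the successor in
    [card_split_parts].  A singleton is both, so it is the union of no
    disjoint pair, and this pays for the summand #|W| == 1. *)
Lemma card_fiber_le W : #|fiber W| + (#|W| == 1) <= 2 * #|W|.
Proof.
have [KS|] := boolP (clique G W || stable G W); last first.
  by rewrite negb_or => /andP[nK nS]; apply/ltnW/card_fiber_lt.
have := card_fiber_split W; have := card_swing W; have := card_split_parts W.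
have pW : (W \in split_parts W) = clique G W.
  by rewrite inE subxx setDv stable0 andbT.
have p0 : (set0 \in split_parts W) = stable G W.
  by rewrite inE sub0set clique0 setD0.
have := cardsD1 W (split_parts W :\ set0); have := cardsD1 set0 (split_parts W).
rewrite p0 in_setD1 pW.
have [W0|W0] := eqVneq W set0.
  have -> : #|fiber W| = 0.
    apply/eqP; rewrite cards_eq0; apply/eqP/setP => -[K S]; rewrite !inE /= W0.
    by rewrite setU_eq0; case: (K == set0); rewrite ?andbF.
  by rewrite W0 cards0.
have Wpos : 0 < #|W| by rewrite card_gt0.
have [/cards1P[x ->]|] := boolP (#|W| == 1).
  rewrite clique1 stable1 cards1; lia.
by case: (clique G W) KS; case: (stable G W) => //= _; lia.
Qed.

Lemma sum_card_fiber :
  \sum_(W : {set V}) #|fiber W| = #|cliques G| * #|stables G|.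
Proof.
rewrite -cardsX -sum1_card (partition_big (fun p => p.1 :|: p.2) predT) //=.
by apply: eq_bigr => W _; rewrite -sum1_card; apply: eq_bigl => p; rewrite inE.
Qed.

(** * Summation over all unions *)

(** Each set is paired with its complement. *)
Lemma sum_card_sets : \sum_(W : {set V}) 2 * #|W| = #|V| * 2 ^ #|V|.
Proof.
rewrite -big_distrr /= mul2n -addnn.
rewrite {2}(reindex_inj (inv_inj (@setCK V))) -big_split /=.
rewrite (eq_bigr (fun=> #|V|)) => [|W _]; last by rewrite cardsC.
by rewrite sum_nat_const mulnC -(cardsT {set V}) -powersetT card_powerset cardsT.
Qed.

Lemma sum_singletons : \sum_(W : {set V}) (#|W| == 1) = #|V|.
Proof.
by rewrite -big_mkcond /= sum1_card -[RHS]bin1 -card_draws cardsE.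
Qed.

Lemma card_cliques_stables :
  #|cliques G| * #|stables G| + #|V| <= #|V| * 2 ^ #|V|.
Proof.
rewrite -{1}sum_singletons -sum_card_fiber -big_split -sum_card_sets.
by apply: leq_sum => W _; apply: card_fiber_le.
Qed.

Lemma card_cliques_stables_lt : ~~ clique G setT -> ~~ stable G setT ->
  #|cliques G| * #|stables G| + #|V| < #|V| * 2 ^ #|V|.
Proof.
move=> nK nS.
rewrite -{1}sum_singletons -sum_card_fiber -big_split -sum_card_sets /=.
rewrite (bigD1 setT) // [ltnRHS](bigD1 setT) //= -addSn.
by rewrite leq_add ?card_fiber_lt ?leq_sum // => W _; apply: card_fiber_le.
Qed.

End Fibers.

(** * Complete graphs and complementation *)

Section Complete.
Variables (V : finType) (G : sgraph V).
Implicit Types A : {set V}.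

Lemma complete_clique : complete G <-> clique G setT.
Proof.
by split=> [h|/cliqueP h x y]; [apply/cliqueP => x y _ _; apply: h | apply: h].
Qed.

Lemma clique_compl A : clique (compl_graph G) A = stable G A.
Proof.
by apply/cliqueP/stableP => h x y xA yA xy; have := h x y xA yA xy;
  rewrite /= /compl_adj xy.
Qed.

Lemma stable_compl A : stable (compl_graph G) A = clique G A.
Proof.
by apply/stableP/cliqueP => h x y xA yA xy; have := h x y xA yA xy;
  rewrite /= /compl_adj xy negbK.
Qed.

Lemma cliques_compl : cliques (compl_graph G) = stables G.
Proof. by apply/setP => A; rewrite !inE clique_compl. Qed.

Lemma stables_compl : stables (compl_graph G) = cliques G.
Proof. by apply/setP => A; rewrite !inE stable_compl. Qed.

Lemma card_cliques_complete : complete G -> #|cliques G| = 2 ^ #|V| - 1.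
Proof.
move=> h; have -> : cliques G = powerset setT :\ set0.
  apply/setP => A; rewrite !inE subsetT andbT; case: eqP => //= _.
  by apply: cliqueS (subsetT A) _; apply/complete_clique.
rewrite -cardsT -card_powerset (cardsD1 set0 (powerset setT)).
by rewrite inE sub0set addKn.
Qed.

Lemma card_stables_complete : complete G -> #|stables G| = #|V|.
Proof.
move=> h; rewrite -[RHS]bin1 -card_draws; apply: eq_card => A; rewrite !inE.
apply/andP/cards1P => [[/set0Pn[x xA] /stableP hA]|[x ->]]; last first.
  by rewrite -cards_eq0 cards1 stable1.
exists x; apply/eqP; rewrite eqEsubset sub1set xA andbT.
apply/subsetP => y yA; rewrite inE; apply/negPn/negP => yx.
by have := hA y x yA xA yx; rewrite h.
Qed.

End Complete.

Theorem theorem5 (V : finType) (G : sgraph V) (n : nat) (hn : #|V| = n) :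
  #|cliques G| * #|stables G| <= n * (2 ^ n - 1) /\
  (#|cliques G| * #|stables G| = n * (2 ^ n - 1) <->
     complete G \/ complete (compl_graph G)).
Proof.
rewrite mulnBr muln1 -hn.
have le := card_cliques_stables G; split; first lia.
split=> [e|[h|h]].
- have [hK|nK] := boolP (clique G setT); first by left; apply/complete_clique.
  right; apply/complete_clique; rewrite clique_compl; apply/negPn/negP => nS.
  by have := card_cliques_stables_lt nK nS; lia.
- rewrite card_cliques_complete // card_stables_complete //.
  by rewrite mulnC mulnBr muln1.
rewrite -(cliques_compl G) -(stables_compl G).
by rewrite card_cliques_complete // card_stables_complete // mulnBr muln1.
Qed.
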